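(* Let $k$ be a difference ring with difference operator $\sigma_k$, and let $L_0$ be a separable closure of the underlying ring $\lfloor k\rfloor$. Then $L_0$ can be made into a difference ring extension of $k$; that is, there is a ring endomorphism $\bar{\sigma}:L_0\to L_0$ such that $(L_0,\bar{\sigma})$ is a difference ring extension of $(\lfloor k\rfloor,\sigma_k)$ via the structure map $\lfloor k\rfloor\to L_0$.
   Context: All rings are commutative and unital. A difference ring is a ring with a ring endomorphism; morphisms commute with the endomorphisms; $\lfloor k\rfloor$ is the underlying ring. An extension $A/R$ of (difference) rings is an $R$-algebra with $R\to A$ injective. For a ring $R$, $E(R)$ is the Boolean algebra of idempotents and $S_0(R)=\mathrm{Spec}(E(R))$; for $x\in S_0(R)$, $R_x=R/P_xR$ with $P_x\subset E(R)$ the corresponding prime ideal. An extension $A/R$ is separable if $A$ is a projective $A\otimes_RA$-module; strongly separable if it is separable and $A$ is a finite projective $R$-module; locally strongly separable if it is a colimit of strongly separable extensions of $R$; clss (componentially locally strongly separable) if for each $x\in S_0(R)$, $R_x\otimes_RA$ is a locally strongly separable extension of $R_x$. A ring $L$ is separably closed if, for every clss extension $M/L$, there is an $L$-algebra map $M\to L$. A clss extension $L/R$ is minimal if every $R$-algebra map $L\to M$ to a clss extension $M/R$ is a monomorphism. $L$ is a separable closure of $R$ if $L$ is separably closed and $L/R$ is a minimal clss extension. *)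

(* Defs.v *)
From HB Require Import structures.
From mathcomp Require Import all_boot all_algebra.
From mathcomp Require Import generic_quotient.
From mathcomp Require Import boolp classical_sets.

Set Implicit Arguments.
Unset Strict Implicit.
Unset Printing Implicit Defensive.

Import GRing.Theory.
Local Open Scope ring_scope.
Local Open Scope quotient_scope.
Local Open Scope classical_set_scope.

(* Conventions.  A (commutative, unital) ring is a [comPzRingType]: the zero
   ring is allowed.  MathComp's [comAlgType R] excludes the zero ring, and
   here a ring is often an algebra over several bases at once, so an
   R-algebra is given by its structure map [f : {rmorphism R -> A}]. *)

Definition extension (R A : comPzRingType) (f : {rmorphism R -> A}) : Prop :=
  injective f.

Definition is_alg_hom (R A B : comPzRingType) (f : {rmorphism R -> A})
    (g : {rmorphism R -> B}) (h : {rmorphism A -> B}) : Prop :=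
  forall r, h (f r) = g r.

Record diffRing := DiffRing {
  underlying :> comPzRingType;
  diff_op : {rmorphism underlying -> underlying} }.

Definition difference_extension (k K : diffRing) (f : {rmorphism k -> K}) :
    Prop :=
  extension f /\ forall r : k, f (diff_op k r) = diff_op K (f r).

Section QuotientRing.
Variables (R : comPzRingType) (P : set R).

Definition ideal_span (x : R) : Prop :=
  exists2 s : seq (R * R),
    (forall p, p \in s -> P p.2) & x = \sum_(p <- s) p.1 * p.2.

Lemma ideal_span0 : ideal_span 0.
Proof. by exists [::] => //; rewrite big_nil. Qed.

Lemma ideal_spanD x y : ideal_span x -> ideal_span y -> ideal_span (x + y).
Proof.
move=> [s sP ->] [t tP ->]; exists (s ++ t); last by rewrite big_cat.
by move=> p; rewrite mem_cat => /orP[/sP|/tP].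
Qed.

Lemma ideal_spanM a x : ideal_span x -> ideal_span (a * x).
Proof.
move=> [s sP ->]; exists [seq (a * p.1, p.2) | p <- s].
  by move=> _ /mapP[p /sP Pp ->].
by rewrite big_map mulr_sumr; apply: eq_bigr => p _; rewrite mulrA.
Qed.

Lemma ideal_spanN x : ideal_span x -> ideal_span (- x).
Proof. by move=> /(ideal_spanM (-1)); rewrite mulN1r. Qed.

Definition quot_rel (x y : R) : bool := `[< ideal_span (x - y) >].

Lemma quot_rel_refl : reflexive quot_rel.
Proof. by move=> x; apply/asboolP; rewrite subrr; exact: ideal_span0. Qed.

Lemma quot_rel_sym : symmetric quot_rel.
Proof.
by move=> x y; apply/asboolP/asboolP => /ideal_spanN; rewrite opprB.
Qed.

Lemma quot_rel_trans : transitive quot_rel.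
Proof.
move=> y x z /asboolP xy /asboolP yz; apply/asboolP.
by have := ideal_spanD xy yz; rewrite addrA subrK.
Qed.

Canonical quot_equiv :=
  EquivRel quot_rel quot_rel_refl quot_rel_sym quot_rel_trans.

Definition quot_ring : Type := {eq_quot quot_equiv}.

HB.instance Definition _ := Choice.on quot_ring.
HB.instance Definition _ : EqQuotient R quot_equiv quot_ring :=
  EqQuotient.on quot_ring.

Local Notation Q := quot_ring.
Local Notation cl := (\pi_quot_ring : R -> quot_ring).

Lemma quot_ind (K : Q -> Prop) : (forall x, K (cl x)) -> forall u, K u.
Proof. by move=> Kcl u; rewrite -[u]reprK. Qed.

Lemma quot_clP x y : cl x = cl y <-> ideal_span (x - y).
Proof.
by split=> [/eqquotP/asboolP //|h]; apply/eqquotP/asboolP.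
Qed.

Definition quot_add (u v : Q) : Q := cl (repr u + repr v).
Definition quot_mul (u v : Q) : Q := cl (repr u * repr v).
Definition quot_opp (u : Q) : Q := cl (- repr u).

Lemma quot_reprP x : ideal_span (repr (cl x) - x).
Proof. by apply/quot_clP; rewrite reprK. Qed.

Lemma quot_addE x y : quot_add (cl x) (cl y) = cl (x + y).
Proof.
apply/quot_clP; rewrite opprD addrACA.
exact: ideal_spanD (quot_reprP x) (quot_reprP y).
Qed.

Lemma quot_oppE x : quot_opp (cl x) = cl (- x).
Proof. by apply/quot_clP; rewrite -opprD; apply/ideal_spanN/quot_reprP. Qed.

Lemma quot_mulE x y : quot_mul (cl x) (cl y) = cl (x * y).
Proof.
apply/quot_clP; set x' := repr _; set y' := repr _.
have -> : x' * y' - x * y = x' * (y' - y) + y * (x' - x).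
  by rewrite !mulrBr addrA [y * x']mulrC subrK [y * x]mulrC.
by apply: ideal_spanD; apply: ideal_spanM; apply: quot_reprP.
Qed.

Lemma quot_addA : associative quot_add.
Proof. by elim/quot_ind=> x; elim/quot_ind=> y; elim/quot_ind=> z; rewrite !quot_addE addrA. Qed.
Lemma quot_addC : commutative quot_add.
Proof. by elim/quot_ind=> x; elim/quot_ind=> y; rewrite !quot_addE addrC. Qed.
Lemma quot_add0 : left_id (cl 0) quot_add.
Proof. by elim/quot_ind=> x; rewrite !quot_addE add0r. Qed.
Lemma quot_addN : left_inverse (cl 0) quot_opp quot_add.
Proof. by elim/quot_ind=> x; rewrite quot_oppE quot_addE addNr. Qed.

HB.instance Definition _ :=
  GRing.isZmodule.Build Q quot_addA quot_addC quot_add0 quot_addN.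

Lemma quot_mulA : associative quot_mul.
Proof. by elim/quot_ind=> x; elim/quot_ind=> y; elim/quot_ind=> z; rewrite !quot_mulE mulrA. Qed.
Lemma quot_mulC : commutative quot_mul.
Proof. by elim/quot_ind=> x; elim/quot_ind=> y; rewrite !quot_mulE mulrC. Qed.
Lemma quot_mul1 : left_id (cl 1) quot_mul.
Proof. by elim/quot_ind=> x; rewrite !quot_mulE mul1r. Qed.
Lemma quot_mulD : left_distributive quot_mul +%R.
Proof.
elim/quot_ind=> x; elim/quot_ind=> y; elim/quot_ind=> z.
rewrite -[LHS]/(quot_mul (quot_add _ _) _) -[RHS]/(quot_add _ _).
by rewrite !(quot_addE, quot_mulE) mulrDl.
Qed.

HB.instance Definition _ :=
  GRing.Zmodule_isComPzRing.Build Q quot_mulA quot_mulC quot_mul1 quot_mulD.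

Definition quot_proj (x : R) : quot_ring := cl x.

Lemma quot_proj_is_zmod_morphism : zmod_morphism quot_proj.
Proof.
by move=> x y; rewrite -[RHS]/(quot_add (cl x) (quot_opp (cl y))) quot_oppE quot_addE.
Qed.
Lemma quot_proj_is_monoid_morphism : monoid_morphism quot_proj.
Proof.
by split=> // x y; rewrite -[RHS]/(quot_mul (cl x) (cl y)) quot_mulE.
Qed.

HB.instance Definition _ :=
  GRing.isZmodMorphism.Build R quot_ring quot_proj quot_proj_is_zmod_morphism.
HB.instance Definition _ :=
  GRing.isMonoidMorphism.Build R quot_ring quot_proj
    quot_proj_is_monoid_morphism.

Lemma quot_proj_surj (u : quot_ring) : exists x, quot_proj x = u.
Proof. by exists (repr u); exact: reprK. Qed.

Lemma quot_proj_eq0 x : quot_proj x = 0 <-> ideal_span x.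
Proof. by rewrite -[X in ideal_span X]subr0; exact: quot_clP. Qed.

End QuotientRing.

Definition idempotents (R : comPzRingType) : set R := [set e | e * e = e].

(* The Boolean algebra structure on [idempotents R] has meet [e * f], join
   [e + f - e * f], bottom 0 and top 1. *)
Record is_bool_prime (R : comPzRingType) (P : set R) : Prop := IsBoolPrime {
  bool_prime_sub : P `<=` @idempotents R;
  bool_prime0 : P 0;
  bool_primeU : forall e f, P e -> P f -> P (e + f - e * f);
  bool_primeI : forall e f, P e -> idempotents f -> P (e * f);
  bool_prime1 : ~ P 1;
  bool_primeP : forall e f, idempotents e -> idempotents f ->
    P (e * f) -> P e \/ P f }.

Record bool_spec (R : comPzRingType) := BoolSpec {
  bool_spec_set :> set R;
  bool_specP : is_bool_prime bool_spec_set }.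

(* R_x = R / P_x R *)
Definition component (R : comPzRingType) (x : bool_spec R) : comPzRingType :=
  quot_ring x.

(* A (x)_R B is the set of formal sums of pure tensors, two sums being
   identified when no R-balanced biadditive map to an abelian group separates
   them.  Formal sums are finite sequences of pairs: no negative coefficients
   are needed since -(a (x) b) = (-a) (x) b. *)

Section Tensor.
Variables (R A B : comPzRingType).
Variables (f : {rmorphism R -> A}) (g : {rmorphism R -> B}).

Record balanced (G : zmodType) (phi : A -> B -> G) : Prop := Balanced {
  balancedDl : forall a a' b, phi (a + a') b = phi a b + phi a' b;
  balancedDr : forall a b b', phi a (b + b') = phi a b + phi a b';
  balancedM : forall a r b, phi (a * f r) b = phi a (g r * b) }.

Definition teval (G : zmodType) (phi : A -> B -> G) (s : seq (A * B)) : G :=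
  \sum_(p <- s) phi p.1 p.2.

Definition tens_eq (s t : seq (A * B)) : Prop :=
  forall (G : zmodType) (phi : A -> B -> G),
    balanced phi -> teval phi s = teval phi t.

Definition tens_rel (s t : seq (A * B)) : bool := `[< tens_eq s t >].

Lemma tens_rel_refl : reflexive tens_rel.
Proof. by move=> s; apply/asboolP. Qed.
Lemma tens_rel_sym : symmetric tens_rel.
Proof. by move=> s t; apply/asboolP/asboolP => st G phi /st. Qed.
Lemma tens_rel_trans : transitive tens_rel.
Proof.
move=> t s u /asboolP st /asboolP tu; apply/asboolP => G phi bphi.
by rewrite st ?tu.
Qed.

Canonical tens_equiv :=
  EquivRel tens_rel tens_rel_refl tens_rel_sym tens_rel_trans.

Definition tensor : Type := {eq_quot tens_equiv}.

HB.instance Definition _ := Choice.on tensor.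
HB.instance Definition _ : EqQuotient (seq (A * B)) tens_equiv tensor :=
  EqQuotient.on tensor.

Local Notation cl := (\pi_tensor : seq (A * B) -> tensor).

Lemma tens_ind (K : tensor -> Prop) : (forall s, K (cl s)) -> forall u, K u.
Proof. by move=> Kcl u; rewrite -[u]reprK. Qed.

Lemma tens_clP s t : cl s = cl t <-> tens_eq s t.
Proof.
by split=> [/eqquotP/asboolP //|h]; apply/eqquotP/asboolP.
Qed.

Lemma tens_reprP s : tens_eq (repr (cl s)) s.
Proof. by apply/tens_clP; rewrite reprK. Qed.

Section BalancedTheory.
Variables (G : zmodType) (phi : A -> B -> G).

Lemma teval_cat s t : teval phi (s ++ t) = teval phi s + teval phi t.
Proof. exact: big_cat. Qed.

Hypothesis bphi : balanced phi.

Lemma balanced0l b : phi 0 b = 0.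
Proof. by apply: (addrI (phi 0 b)); rewrite -(balancedDl bphi) !addr0. Qed.
Lemma balancedNl a b : phi (- a) b = - phi a b.
Proof.
apply: (addrI (phi a b)).
by rewrite -(balancedDl bphi) !subrr balanced0l.
Qed.
Lemma balanced0r a : phi a 0 = 0.
Proof. by apply: (addrI (phi a 0)); rewrite -(balancedDr bphi) !addr0. Qed.

Lemma balanced_suml (I : Type) (r : seq I) (F : I -> A) b :
  phi (\sum_(i <- r) F i) b = \sum_(i <- r) phi (F i) b.
Proof.
by apply: (big_morph (phi^~ b)) => [? ?|]; rewrite ?balanced0l ?(balancedDl bphi).
Qed.
End BalancedTheory.

Definition seq_opp (s : seq (A * B)) := [seq (- p.1, p.2) | p <- s].
Definition seq_mul (s t : seq (A * B)) :=
  [seq (p.1 * q.1, p.2 * q.2) | p <- s, q <- t].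

Definition tens_add (u v : tensor) : tensor := cl (repr u ++ repr v).
Definition tens_opp (u : tensor) : tensor := cl (seq_opp (repr u)).
Definition tens_mul (u v : tensor) : tensor := cl (seq_mul (repr u) (repr v)).

Lemma teval_opp (G : zmodType) (phi : A -> B -> G) s :
  balanced phi -> teval phi (seq_opp s) = - teval phi s.
Proof.
move=> bphi; rewrite /teval big_map -sumrN.
by apply: eq_bigr => p _; rewrite balancedNl.
Qed.

Lemma teval_mul (G : zmodType) (phi : A -> B -> G) s t :
  teval phi (seq_mul s t) =
  \sum_(p <- s) \sum_(q <- t) phi (p.1 * q.1) (p.2 * q.2).
Proof. by rewrite /teval /seq_mul big_allpairs_dep. Qed.

Lemma seq_mulC s t : tens_eq (seq_mul s t) (seq_mul t s).
Proof.
move=> G phi bphi; rewrite !teval_mul exchange_big /=.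
by apply: eq_bigr => q _; apply: eq_bigr => p _; rewrite !(mulrC p.1) !(mulrC p.2).
Qed.

Lemma seq_mul_eql s s' t : tens_eq s s' -> tens_eq (seq_mul s t) (seq_mul s' t).
Proof.
move=> ss' G phi bphi; rewrite !teval_mul.
pose psi (a : A) (b : B) := \sum_(q <- t) phi (a * q.1) (b * q.2).
suff /ss' : balanced psi by [].
split=> [a a' b|a b b'|a r b]; rewrite /psi -?big_split; apply: eq_bigr => q _ /=.
- by rewrite mulrDl (balancedDl bphi).
- by rewrite mulrDl (balancedDr bphi).
- by rewrite mulrAC (balancedM bphi) mulrA.
Qed.

Lemma tens_addE s t : tens_add (cl s) (cl t) = cl (s ++ t).
Proof.
apply/tens_clP => G phi bphi; rewrite !teval_cat.
by rewrite !(tens_reprP _ bphi).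
Qed.

Lemma tens_oppE s : tens_opp (cl s) = cl (seq_opp s).
Proof.
by apply/tens_clP => G phi bphi; rewrite !teval_opp // (tens_reprP _ bphi).
Qed.

Lemma tens_mulE s t : tens_mul (cl s) (cl t) = cl (seq_mul s t).
Proof.
apply/tens_clP => G phi bphi.
rewrite (seq_mul_eql _ (tens_reprP s) bphi) (seq_mulC _ _ bphi).
by rewrite (seq_mul_eql _ (tens_reprP t) bphi) (seq_mulC _ _ bphi).
Qed.

Lemma tens_addA : associative tens_add.
Proof. by elim/tens_ind=> x; elim/tens_ind=> y; elim/tens_ind=> z; rewrite !tens_addE catA. Qed.
Lemma tens_addC : commutative tens_add.
Proof.
elim/tens_ind=> x; elim/tens_ind=> y; rewrite !tens_addE.
by apply/tens_clP => G phi _; rewrite !teval_cat addrC.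
Qed.
Lemma tens_add0 : left_id (cl [::]) tens_add.
Proof. by elim/tens_ind=> x; rewrite !tens_addE. Qed.
Lemma tens_addN : left_inverse (cl [::]) tens_opp tens_add.
Proof.
elim/tens_ind=> x; rewrite tens_oppE tens_addE; apply/tens_clP => G phi bphi.
by rewrite teval_cat teval_opp // addNr /teval big_nil.
Qed.

HB.instance Definition _ :=
  GRing.isZmodule.Build tensor tens_addA tens_addC tens_add0 tens_addN.

Lemma tens_mulA : associative tens_mul.
Proof.
elim/tens_ind=> x; elim/tens_ind=> y; elim/tens_ind=> z; rewrite !tens_mulE.
apply/tens_clP => G phi bphi; rewrite !teval_mul [RHS]big_allpairs_dep.
apply: eq_bigr => p _; rewrite big_allpairs_dep; apply: eq_bigr => q _ /=.
by apply: eq_bigr => r _; rewrite !mulrA.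
Qed.
Lemma tens_mulC : commutative tens_mul.
Proof.
elim/tens_ind=> x; elim/tens_ind=> y; rewrite !tens_mulE.
by apply/tens_clP/seq_mulC.
Qed.
Lemma tens_mul1 : left_id (cl [:: (1, 1)]) tens_mul.
Proof.
elim/tens_ind=> x; rewrite tens_mulE; apply/tens_clP => G phi bphi.
by rewrite teval_mul big_seq1; apply: eq_bigr => p _; rewrite !mul1r.
Qed.
Lemma tens_mulD : left_distributive tens_mul +%R.
Proof.
elim/tens_ind=> x; elim/tens_ind=> y; elim/tens_ind=> z.
rewrite -[LHS]/(tens_mul (tens_add _ _) _) -[RHS]/(tens_add _ _).
rewrite !(tens_addE, tens_mulE); apply/tens_clP => G phi _.
by rewrite teval_cat !teval_mul big_cat.
Qed.

HB.instance Definition _ :=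
  GRing.Zmodule_isComPzRing.Build tensor tens_mulA tens_mulC tens_mul1 tens_mulD.

Definition tens (a : A) (b : B) : tensor := cl [:: (a, b)].

Lemma tensDl a a' b : tens (a + a') b = tens a b + tens a' b.
Proof.
rewrite -[RHS]/(tens_add _ _) tens_addE; apply/tens_clP => G phi bphi.
by rewrite teval_cat /teval !big_seq1 (balancedDl bphi).
Qed.

Lemma tensDr a b b' : tens a (b + b') = tens a b + tens a b'.
Proof.
rewrite -[RHS]/(tens_add _ _) tens_addE; apply/tens_clP => G phi bphi.
by rewrite teval_cat /teval !big_seq1 (balancedDr bphi).
Qed.

Lemma tens_middle a r b : tens (a * f r) b = tens a (g r * b).
Proof.
by apply/tens_clP => G phi bphi; rewrite /teval !big_seq1 (balancedM bphi).
Qed.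

Lemma tens_balanced : balanced tens.
Proof. by split; [exact: tensDl | exact: tensDr | exact: tens_middle]. Qed.

Lemma tensM a a' b b' : tens a b * tens a' b' = tens (a * a') (b * b').
Proof. by rewrite -[LHS]/(tens_mul _ _) tens_mulE. Qed.

Lemma tens_clE s : cl s = \sum_(p <- s) tens p.1 p.2.
Proof.
elim: s => [|p s IHs]; first by rewrite big_nil.
by rewrite big_cons -IHs -[RHS]/(tens_add _ _) tens_addE; case: p.
Qed.

Lemma tens_gen (u : tensor) :
  exists s : seq (A * B), u = \sum_(p <- s) tens p.1 p.2.
Proof. by exists (repr u); rewrite -tens_clE reprK. Qed.

Definition tens_lift (G : zmodType) (phi : A -> B -> G) (u : tensor) : G :=
  teval phi (repr u).

Lemma tens_lift_cl (G : zmodType) (phi : A -> B -> G) s :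
  balanced phi -> tens_lift phi (cl s) = teval phi s.
Proof. by move=> bphi; apply: (tens_reprP _ bphi). Qed.

Lemma tens_liftE (G : zmodType) (phi : A -> B -> G) a b :
  balanced phi -> tens_lift phi (tens a b) = phi a b.
Proof. by move=> bphi; rewrite tens_lift_cl // /teval big_seq1. Qed.

Lemma tens_lift_is_zmod_morphism (G : zmodType) (phi : A -> B -> G) :
  balanced phi -> zmod_morphism (tens_lift phi).
Proof.
move=> bphi; elim/tens_ind=> x; elim/tens_ind=> y.
rewrite -[cl x - cl y]/(tens_add _ (tens_opp _)) tens_oppE tens_addE.
by rewrite !tens_lift_cl // teval_cat teval_opp.
Qed.

Definition tens_inl (a : A) : tensor := tens a 1.
Definition tens_inr (b : B) : tensor := tens 1 b.

Lemma tens_inl_is_zmod_morphism : zmod_morphism tens_inl.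
Proof.
by move=> a a'; apply/eqP; rewrite eq_sym subr_eq /tens_inl -tensDl subrK.
Qed.
Lemma tens_inl_is_monoid_morphism : monoid_morphism tens_inl.
Proof. by split=> // a a'; rewrite /tens_inl tensM mul1r. Qed.
HB.instance Definition _ :=
  GRing.isZmodMorphism.Build A tensor tens_inl tens_inl_is_zmod_morphism.
HB.instance Definition _ :=
  GRing.isMonoidMorphism.Build A tensor tens_inl tens_inl_is_monoid_morphism.

Lemma tens_inr_is_zmod_morphism : zmod_morphism tens_inr.
Proof.
by move=> b b'; apply/eqP; rewrite eq_sym subr_eq /tens_inr -tensDr subrK.
Qed.
Lemma tens_inr_is_monoid_morphism : monoid_morphism tens_inr.
Proof. by split=> // b b'; rewrite /tens_inr tensM mul1r. Qed.
HB.instance Definition _ :=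
  GRing.isZmodMorphism.Build B tensor tens_inr tens_inr_is_zmod_morphism.
HB.instance Definition _ :=
  GRing.isMonoidMorphism.Build B tensor tens_inr tens_inr_is_monoid_morphism.

Lemma tens_in_comm r : tens_inl (f r) = tens_inr (g r).
Proof. by rewrite /tens_inl -[f r]mul1r tens_middle mulr1. Qed.

End Tensor.

Section Multiplication.
Variables (R A : comPzRingType) (f : {rmorphism R -> A}).

Definition tens_mult : tensor f f -> A := tens_lift *%R.

Lemma mul_balanced : balanced f f (@GRing.mul A).
Proof. by split=> *; rewrite ?mulrDl ?mulrDr ?mulrA. Qed.

Lemma tens_multE a b : tens_mult (tens f f a b) = a * b.
Proof. exact: tens_liftE mul_balanced. Qed.

Lemma tens_mult_is_zmod_morphism : zmod_morphism tens_mult.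
Proof. exact: tens_lift_is_zmod_morphism mul_balanced. Qed.

HB.instance Definition _ :=
  GRing.isZmodMorphism.Build (tensor f f) A tens_mult tens_mult_is_zmod_morphism.

Lemma tens_mult_is_monoid_morphism : monoid_morphism tens_mult.
Proof.
split=> [|u v]; first by rewrite -[1]/(tens f f 1 1) tens_multE mul1r.
have [s ->] := tens_gen u; have [t ->] := tens_gen v.
rewrite mulr_suml !raddf_sum mulr_suml; apply: eq_bigr => p _.
rewrite mulr_sumr !raddf_sum mulr_sumr; apply: eq_bigr => q _ /=.
by rewrite tensM !tens_multE mulrACA.
Qed.

HB.instance Definition _ :=
  GRing.isMonoidMorphism.Build (tensor f f) A tens_mult
    tens_mult_is_monoid_morphism.

End Multiplication.

Definition restr_mod (R A : comPzRingType) (f : {rmorphism R -> A}) : Type := A.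

Section RestrMod.
Variables (R A : comPzRingType) (f : {rmorphism R -> A}).

HB.instance Definition _ := GRing.Zmodule.on (restr_mod f).

Definition restr_scale (r : R) (a : restr_mod f) : restr_mod f :=
  (f r * (a : A) : A).

Lemma restr_scaleA r s a :
  restr_scale r (restr_scale s a) = restr_scale (r * s) a.
Proof. by rewrite /restr_scale rmorphM mulrA. Qed.
Lemma restr_scale1 : left_id 1 restr_scale.
Proof. by move=> a; rewrite /restr_scale rmorph1 mul1r. Qed.
Lemma restr_scaleDr : right_distributive restr_scale +%R.
Proof. by move=> r a b; rewrite /restr_scale mulrDr. Qed.
Lemma restr_scaleDl a : {morph restr_scale^~ a : r s / r + s}.
Proof. by move=> r s; rewrite /restr_scale rmorphD mulrDl. Qed.

HB.instance Definition _ := GRing.Zmodule_isLmodule.Build R (restr_mod f)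
  restr_scaleA restr_scale1 restr_scaleDr restr_scaleDl.

End RestrMod.

Definition projective (R : comPzRingType) (P : lmodType R) : Prop :=
  forall (M N : lmodType R) (g : {linear M -> N}) (h : {linear P -> N}),
    (forall y, exists x, g x = y) ->
    exists l : {linear P -> M}, forall p, g (l p) = h p.

Definition finitely_generated (R : comPzRingType) (P : lmodType R) : Prop :=
  exists (n : nat) (e : 'I_n -> P),
    forall p, exists c : 'I_n -> R, p = \sum_(i < n) c i *: e i.

Definition separable_ext (R A : comPzRingType) (f : {rmorphism R -> A}) : Prop :=
  extension f /\ projective (restr_mod (@tens_mult R A f)).

Definition strongly_separable (R A : comPzRingType)
    (f : {rmorphism R -> A}) : Prop :=
  [/\ separable_ext f, finitely_generated (restr_mod f) & projective (restr_mod f)].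

Record category := Category {
  ob :> Type;
  hom : ob -> ob -> Type;
  idm : forall i, hom i i;
  hcomp : forall i j l, hom i j -> hom j l -> hom i l;
  hcomp_idl : forall i j (u : hom i j), hcomp (idm i) u = u;
  hcomp_idr : forall i j (u : hom i j), hcomp u (idm j) = u;
  hcompA : forall i j l m (u : hom i j) (v : hom j l) (w : hom l m),
    hcomp u (hcomp v w) = hcomp (hcomp u v) w }.

Record alg_diagram (R : comPzRingType) (C : category) := AlgDiagram {
  dob : C -> comPzRingType;
  dstr : forall i, {rmorphism R -> dob i};
  dmap : forall i j : C, hom i j -> {rmorphism dob i -> dob j};
  dmap_alg : forall i j (u : hom i j), is_alg_hom (dstr i) (dstr j) (dmap u);
  dmap_id : forall i a, dmap (idm i) a = a;
  dmap_comp : forall i j l (u : hom i j) (v : hom j l) a,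
    dmap (hcomp u v) a = dmap v (dmap u a) }.

Record is_cocone (R : comPzRingType) (C : category) (D : alg_diagram R C)
    (A : comPzRingType) (f : {rmorphism R -> A})
    (c : forall i : C, {rmorphism dob D i -> A}) : Prop := IsCocone {
  cocone_alg : forall i, is_alg_hom (dstr D i) f (c i);
  cocone_comm : forall i j (u : hom i j) a, c j (dmap D u a) = c i a }.

Definition is_colimit (R : comPzRingType) (C : category) (D : alg_diagram R C)
    (A : comPzRingType) (f : {rmorphism R -> A})
    (c : forall i : C, {rmorphism dob D i -> A}) : Prop :=
  is_cocone f c /\
  forall (B : comPzRingType) (g : {rmorphism R -> B})
         (d : forall i : C, {rmorphism dob D i -> B}),
    is_cocone g d ->
    exists h : {rmorphism A -> B},
      [/\ is_alg_hom f g h,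
          forall i a, h (c i a) = d i a
        & forall h' : {rmorphism A -> B}, is_alg_hom f g h' ->
            (forall i a, h' (c i a) = d i a) -> h' =1 h].

Definition locally_strongly_separable (R A : comPzRingType)
    (f : {rmorphism R -> A}) : Prop :=
  extension f /\
  exists (C : category) (D : alg_diagram R C)
         (c : forall i : C, {rmorphism dob D i -> A}),
    (forall i, strongly_separable (dstr D i)) /\ is_colimit f c.

Definition clss (R A : comPzRingType) (f : {rmorphism R -> A}) : Prop :=
  extension f /\
  forall x : bool_spec R,
    locally_strongly_separable
      (@tens_inl R (component x) A (@quot_proj R x) f
        : {rmorphism component x -> tensor (@quot_proj R x) f}).

Definition separably_closed (L : comPzRingType) : Prop :=
  forall (M : comPzRingType) (m : {rmorphism L -> M}),
    clss m -> exists h : {rmorphism M -> L}, forall x, h (m x) = x.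

Definition minimal_clss (R L : comPzRingType) (f : {rmorphism R -> L}) : Prop :=
  clss f /\
  forall (M : comPzRingType) (g : {rmorphism R -> M}), clss g ->
    forall h : {rmorphism L -> M}, is_alg_hom f g h -> injective h.

Definition separable_closure (R L : comPzRingType)
    (f : {rmorphism R -> L}) : Prop :=
  separably_closed L /\ minimal_clss f.

(* Main.v *)
Require Import Defs.
From Stdlib Require List.
From HB Require Import structures.
From mathcomp Require Import all_boot all_algebra.
From mathcomp Require Import boolp classical_sets.

Set Implicit Arguments.
Unset Strict Implicit.
Unset Printing Implicit Defensive.

Import GRing.Theory.
Local Open Scope ring_scope.

(** Write R for the ring of k and sigma for its operator, and regard L0 as an
    R-algebra in a second way, through eta o sigma.  The ring
    L0 (x)_R L0, formed with the twisted structure on the left factor and eta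
    on the right one, is the base change of the clss extension eta along
    eta o sigma : R -> L0, and it is again a clss extension of L0
    ([clss_base_change]).  Since L0 is separably closed, the left inclusion of
    L0 has a retraction h, and h composed with the right inclusion is the
    endomorphism sought: eta r on the right equals eta (sigma r) on the left.

    So everything rests on the stability of clss extensions under an arbitrary
    base change R -> S.  A point y of S_0(S) restricts to a point x of S_0(R),
    and the component at y of S (x)_R A is the base change of the component
    R_x (x)_R A along R_x -> S_y ([component_pushout]).  The ring R_x is
    connected ([component_connected]), which reduces the question to locally
    strongly separable extensions of a connected ring.  Colimits commute with
    base change, and each strongly separable stage remains strongly separable,
    because separability means having a separability idempotent
    ([separableP]) and being finite projective means having a finite dual
    basis ([finite_projectiveP]); both can be transported along R -> S.

    The delicate point is injectivity of S -> S (x)_R A for a colimit A of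
    strongly separable R-algebras, because the colimit is over an arbitrary
    small category and its structure maps need not be flat a priori
    ([colimit_base_change_injective]).  Finitely many arrows of the diagram
    can be satisfied in one finite projective R-algebra B mapping to A
    ([finite_stage]): tensor the finitely many objects together, then impose
    each arrow, which amounts to dividing by an idempotent since the source is
    separable ([coequalize_separable]).  As 1 is nonzero in A it is nonzero in
    B, and over a connected base R -> B then splits ([finite_projective_split]),
    so that S -> S (x)_R B is injective.  A reduced product of the rings
    S (x)_R B over all finite sets of arrows receives a cocone from the whole
    diagram, hence a map from S (x)_R A, while S still embeds in it.

    Finally S -> S (x)_R A is injective because it is so at every y, and an
    element of S vanishing in all components is zero
    ([components_separate]). *)

(** * Ring morphisms, tensor products and pushouts *)

Lemma rmorphism_of (A B : pzRingType) (h : A -> B) :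
  zmod_morphism h -> monoid_morphism h ->
  exists k : {rmorphism A -> B}, k =1 h.
Proof.
move=> hz hm.
pose k := HB.pack_for {rmorphism A -> B} h
  (GRing.isZmodMorphism.Build A B h hz) (GRing.isMonoidMorphism.Build A B h hm).
by exists k.
Qed.

Lemma additive_of (U V : zmodType) (h : U -> V) :
  zmod_morphism h -> exists k : {additive U -> V}, k =1 h.
Proof.
move=> hz; pose k := HB.pack_for {additive U -> V} h
  (GRing.isZmodMorphism.Build U V h hz).
by exists k.
Qed.

Lemma additiveD (U V : zmodType) (h : U -> V) :
  zmod_morphism h -> {morph h : x y / x + y}.
Proof. by move=> /additive_of[k kh] x y; rewrite -!kh raddfD. Qed.

Lemma quot_desc (R Z : comPzRingType) (P : set R) (p : {rmorphism R -> Z}) :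
  (forall x, P x -> p x = 0) ->
  exists h : {rmorphism quot_ring P -> Z}, forall x, h (quot_proj P x) = p x.
Proof.
move=> pP.
have span0 x : ideal_span P x -> p x = 0.
  move=> [s sP ->]; rewrite rmorph_sum big_seq big1 // => q /sP/pP q0.
  by rewrite rmorphM q0 mulr0.
have preq x y : quot_proj P x = quot_proj P y -> p x = p y.
  move=> /eqP; rewrite -subr_eq0 -rmorphB => /eqP/quot_proj_eq0/span0.
  by rewrite rmorphB => /eqP; rewrite subr_eq0 => /eqP.
have [h hP] : {h : quot_ring P -> Z | forall x, h (quot_proj P x) = p x}.
  exists (fun u => p (projT1 (cid (quot_proj_surj u)))) => x.
  by case: cid => y /= /preq.
have [||k kh] := @rmorphism_of _ _ h.
- move=> u v; have [x <-] := quot_proj_surj u; have [y <-] := quot_proj_surj v.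
  by rewrite -rmorphB !hP rmorphB.
- split=> [|u v]; first by rewrite -(rmorph1 (quot_proj P)) hP rmorph1.
  have [x <-] := quot_proj_surj u; have [y <-] := quot_proj_surj v.
  by rewrite -rmorphM !hP rmorphM.
by exists k => x; rewrite kh.
Qed.

Section TensorUniversal.
Variables (R A B : comPzRingType).
Variables (f : {rmorphism R -> A}) (g : {rmorphism R -> B}).

Lemma tens_factor a b : tens f g a b = tens_inl f g a * tens_inr f g b.
Proof. by rewrite /tens_inl /tens_inr tensM mulr1 mul1r. Qed.

Lemma tensor_desc (T : comPzRingType) (u : {rmorphism A -> T})
    (v : {rmorphism B -> T}) :
  (forall r, u (f r) = v (g r)) ->
  exists h : {rmorphism tensor f g -> T},
    forall a b, h (tens f g a b) = u a * v b.
Proof.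
move=> uv; pose phi a b := u a * v b.
have bphi : balanced f g phi.
  split=> [a a' b|a b b'|a r b]; rewrite /phi ?rmorphD ?mulrDl ?mulrDr //.
  by rewrite !rmorphM uv mulrA.
have hz := tens_lift_is_zmod_morphism bphi.
pose h := HB.pack_for {additive tensor f g -> T} (@tens_lift _ _ _ f g T phi)
  (GRing.isZmodMorphism.Build _ _ _ hz).
have hE a b : h (tens f g a b) = u a * v b by exact: tens_liftE.
have [||k kh] := @rmorphism_of _ _ h.
- exact: hz.
- split=> [|x y]; first by rewrite [LHS](hE 1 1) !rmorph1 mulr1.
  have [s ->] := tens_gen x; have [t ->] := tens_gen y.
  rewrite mulr_suml !raddf_sum mulr_suml; apply: eq_bigr => p _.
  rewrite mulr_sumr !raddf_sum mulr_sumr; apply: eq_bigr => q _ /=.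
  by rewrite tensM !tens_liftE // /phi !rmorphM mulrACA.
by exists k => a b; rewrite kh hE.
Qed.

Lemma tensor_hom_ext (T : pzRingType) (h h' : {rmorphism tensor f g -> T}) :
  (forall a, h (tens_inl f g a) = h' (tens_inl f g a)) ->
  (forall b, h (tens_inr f g b) = h' (tens_inr f g b)) -> h =1 h'.
Proof.
move=> hl hr x; have [s ->] := tens_gen x; rewrite !rmorph_sum.
by apply: eq_bigr => p _; rewrite tens_factor !rmorphM hl hr.
Qed.

End TensorUniversal.

(** Base change is handled through this universal property rather than through
    the tensor product, so that the iterated tensor products arising from
    components need no explicit isomorphisms. *)
Record is_pushout (R S A T : comPzRingType) (g : {rmorphism R -> S})
    (f : {rmorphism R -> A}) (a : {rmorphism S -> T})
    (b : {rmorphism A -> T}) : Prop := IsPushout {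
  pushout_comm : forall r, a (g r) = b (f r);
  pushout_desc : forall (Z : comPzRingType) (p : {rmorphism S -> Z})
      (q : {rmorphism A -> Z}), (forall r, p (g r) = q (f r)) ->
    exists h : {rmorphism T -> Z},
      (forall s, h (a s) = p s) /\ (forall x, h (b x) = q x);
  pushout_ext : forall (Z : comPzRingType) (h h' : {rmorphism T -> Z}),
    (forall s, h (a s) = h' (a s)) -> (forall x, h (b x) = h' (b x)) ->
    h =1 h' }.

(** * Finite projective and separable algebras *)

Section FiniteProjective.
Variables (R A : comPzRingType).

Record dual_basis (f : R -> A) (I : finType) (e : I -> A)
    (phi : I -> A -> R) : Prop := DualBasis {
    dual_basisB : forall i, zmod_morphism (phi i);
    dual_basisM : forall i r a, phi i (f r * a) = r * phi i a;
    dual_basisE : forall a, a = \sum_i f (phi i a) * e i }.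

Definition finite_projective (f : R -> A) : Prop :=
  exists (n : nat) (e : 'I_n -> A) (phi : 'I_n -> A -> R), dual_basis f e phi.

Lemma finite_projective_of (f : R -> A) (I : finType) (e : I -> A)
    (phi : I -> A -> R) :
  dual_basis f e phi -> finite_projective f.
Proof.
move=> [phiB phiM phiE].
exists #|I|, (fun i => e (enum_val i)), (fun i => phi (enum_val i)).
split=> // a; rewrite [LHS]phiE.
by rewrite (reindex (@enum_val I I)) //; exact/onW_bij/enum_val_bij.
Qed.

(** Generators give a surjection from a free module, whose linear section, by
    projectivity, has the dual functionals as coordinates. *)
Lemma finite_projectiveP (f : {rmorphism R -> A}) :
  finitely_generated (restr_mod f) /\ projective (restr_mod f) <->
  finite_projective f.
Proof.
split=> [[[n [e eP]] projA]|[n [e [phi [phiB phiM phiE]]]]].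
  pose lc (c : 'rV[R]_n) : restr_mod f := \sum_i c 0 i *: e i.
  have lc_lin : linear lc.
    move=> r c d; rewrite /lc scaler_sumr -big_split /=.
    by apply: eq_bigr => i _; rewrite !mxE scalerDl scalerA.
  pose g := HB.pack_for {linear 'rV[R]_n -> restr_mod f} lc
    (GRing.isLinear.Build _ _ _ _ lc lc_lin).
  have [y|l lP] := projA _ _ g idfun.
    have [c cE] := eP y; exists (\row_i c i).
    by rewrite /= /lc cE; apply: eq_bigr => i _; rewrite mxE.
  exists n, e, (fun i a => l a 0 i); split.
  - by move=> i a b; rewrite (raddfB l) !mxE.
  - move=> i r a; have -> : f r * a = (r *: (a : restr_mod f)) by [].
    by rewrite linearZ mxE.
  - by move=> a; rewrite -[LHS](lP a).
split; first by exists n, e => p; exists (phi^~ p); exact: phiE.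
move=> M N g h gsurj; have [m mP] := choice (fun i => gsurj (h (e i))).
pose l (p : restr_mod f) : M := \sum_i phi i p *: m i.
have l_lin : linear l.
  move=> r a b; rewrite /l scaler_sumr -big_split /=; apply: eq_bigr => i _.
  have -> : phi i (r *: a + b) = r * phi i a + phi i b.
    by rewrite (additiveD (phiB i)) -phiM.
  by rewrite scalerDl scalerA.
exists (HB.pack_for {linear restr_mod f -> M} l
    (GRing.isLinear.Build _ _ _ _ l l_lin)) => p /=.
rewrite /l linear_sum [in RHS](phiE p) [RHS](linear_sum h).
apply: eq_bigr => i _; rewrite linearZ mP.
exact: (esym (linearZ_LR h (phi i p) (e i : restr_mod f))).
Qed.

End FiniteProjective.

(** The element usually called separability idempotent; its idempotence is the
    instance u = w of [separability_elt_mul]. *)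
Definition separability_elt (R A : comPzRingType) (f : {rmorphism R -> A})
    (w : tensor f f) : Prop :=
  tens_mult w = 1 /\ forall a, tens_inl f f a * w = tens_inr f f a * w.

Lemma separability_elt_mul (R A : comPzRingType) (f : {rmorphism R -> A})
    (w : tensor f f) :
  separability_elt w -> forall u, u * w = tens_inl f f (tens_mult u) * w.
Proof.
move=> [_ wP] u; have [s ->] := tens_gen u.
rewrite (rmorph_sum (@tens_mult _ _ f)) (rmorph_sum (tens_inl f f)) !mulr_suml.
apply: eq_bigr => p _ /=.
by rewrite tens_multE tens_factor -mulrA -wP mulrA rmorphM.
Qed.

(** Multiplication A (x) A -> A is a surjection of A (x) A-modules onto a
    cyclic module; w is the image of 1 under a section of it, and conversely
    a |-> (a (x) 1) w lifts any map as soon as the image of 1 is lifted. *)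
Lemma separableP (R A : comPzRingType) (f : {rmorphism R -> A}) :
  projective (restr_mod (@tens_mult R A f)) <->
  exists w : tensor f f, separability_elt w.
Proof.
split=> [projA|[w wS] M N g h gsurj].
  pose mu (u : (tensor f f)^o) : restr_mod (@tens_mult R A f) := tens_mult u.
  have mu_lin : linear mu by move=> r x y; rewrite /mu rmorphD rmorphM.
  pose g := HB.pack_for {linear (tensor f f)^o -> restr_mod (@tens_mult R A f)}
    mu (GRing.isLinear.Build _ _ _ _ mu mu_lin).
  have [y|l lP] := projA _ _ g idfun.
    by exists (tens_inl f f y); rewrite /= /mu tens_multE mulr1.
  have lM u : l (tens_mult u : A) = u * (l (1 : A) : tensor f f).
    rewrite -[RHS](linearZ_LR l u (1 : A)); congr (l _).
    by rewrite [RHS]mulr1.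
  exists (l (1 : A)); split; first exact: lP.
  by move=> a; rewrite -!lM !tens_multE mul1r mulr1.
have [m mP] := gsurj (h (1 : A)).
pose l (a : restr_mod (@tens_mult R A f)) : M := (tens_inl f f a * w) *: m.
have l_lin : linear l.
  move=> u a b; rewrite /l (_ : u *: a = tens_mult u * (a : A)) //.
  rewrite rmorphD mulrDl scalerDl rmorphM scalerA; congr (_ *: _ + _).
  by rewrite mulrAC -(separability_elt_mul wS) mulrAC -!mulrA.
exists (HB.pack_for {linear restr_mod (@tens_mult R A f) -> M} l
    (GRing.isLinear.Build _ _ _ _ l l_lin)) => a /=.
rewrite /l linearZ mP.
rewrite -[LHS](linearZ_LR h (tens_inl f f a * w) (1 : A)); congr (h _).
transitivity (tens_mult (tens_inl f f a * w)); first exact: mulr1.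
by rewrite rmorphM /= (proj1 wS) mulr1 tens_multE mulr1.
Qed.

Section BaseChange.
Variables (R S A : comPzRingType).
Variables (g : {rmorphism R -> S}) (f : {rmorphism R -> A}).

Local Notation a := (tens_inl g f).
Local Notation b := (tens_inr g f).

(** The image of w under A (x)_R A -> (S (x) A) (x)_S (S (x) A) still works,
    since the elements of S can be moved across the outer tensor sign. *)
Lemma separability_base_change (w : tensor f f) :
  separability_elt w -> exists w' : tensor a a, separability_elt w'.
Proof.
move=> [w1 wP].
have [r|m mE] :=
  @tensor_desc _ _ _ f f _ (tens_inl a a \o b) (tens_inr a a \o b).
  by rewrite /= -!tens_in_comm.
exists (m w); split.
  rewrite -[RHS](rmorph1 b) -w1.
  apply: (@tensor_hom_ext _ _ _ _ _ _ (tens_mult (f := a) \o m)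
    (b \o tens_mult (f := f))) => x /=; rewrite mE rmorph1 ?mulr1 ?mul1r.
    by rewrite /= !tens_multE !mulr1.
  by rewrite /= !tens_multE !mul1r.
move=> t; have [s ->] := tens_gen t.
rewrite !rmorph_sum !mulr_suml; apply: eq_bigr => p _ /=.
rewrite tens_factor !rmorphM /= tens_in_comm -!mulrA; congr (_ * _).
have -> : tens_inl a a (b p.2) = m (tens_inl f f p.2).
  by rewrite mE rmorph1 mulr1.
have -> : tens_inr a a (b p.2) = m (tens_inr f f p.2).
  by rewrite mE rmorph1 mul1r.
by rewrite -!rmorphM wP.
Qed.

Lemma base_change_functional (phi : A -> R) :
  zmod_morphism phi -> (forall r x, phi (f r * x) = r * phi x) ->
  exists psi : {additive tensor g f -> S},
    forall s x, psi (tens g f s x) = s * g (phi x).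
Proof.
move=> phiB phiM.
have bal : balanced g f (fun s x => s * g (phi x)).
  split=> [s s' x|s x x'|s r x]; first by rewrite mulrDl.
    by rewrite (additiveD phiB) rmorphD mulrDr.
  by rewrite phiM rmorphM mulrA.
have [psi psiE] := additive_of (tens_lift_is_zmod_morphism bal).
by exists psi => s x; rewrite psiE tens_liftE.
Qed.

Lemma finite_projective_base_change :
  finite_projective f -> finite_projective a.
Proof.
move=> [n [e [phi [phiB phiM phiE]]]].
have [psi psiE] := choice (fun i => base_change_functional (phiB i) (phiM i)).
exists n, (fun i => b (e i)), (fun i => psi i); split.
- by move=> i; exact: raddfB.
- move=> i s t; have [l ->] := tens_gen t.
  rewrite mulr_sumr !raddf_sum mulr_sumr; apply: eq_bigr => p _ /=.
  by rewrite tensM !psiE mul1r mulrA.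
move=> t; have [l ->] := tens_gen t.
under [RHS]eq_bigr do rewrite !raddf_sum mulr_suml.
rewrite exchange_big; apply: eq_bigr => p _ /=.
under eq_bigr do rewrite psiE rmorphM /= -mulrA tens_in_comm -rmorphM.
by rewrite -mulr_sumr -rmorph_sum -phiE -tens_factor.
Qed.

(** A unital functional on A extends S-linearly to a retraction of
    S -> S (x)_R A. *)
Lemma base_change_injective (phi : A -> R) :
  zmod_morphism phi -> (forall r x, phi (f r * x) = r * phi x) ->
  phi 1 = 1 -> injective a.
Proof.
move=> phiB phiM phi1; have [psi psiE] := base_change_functional phiB phiM.
by apply: (can_inj (g := psi)) => s; rewrite psiE phi1 rmorph1 mulr1.
Qed.

End BaseChange.

Lemma finite_projective_trans (R B C : comPzRingType) (f : {rmorphism R -> B})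
    (g : {rmorphism B -> C}) :
  finite_projective f -> finite_projective g -> finite_projective (g \o f).
Proof.
move=> [n [e [phi [phiB phiM phiE]]]] [m [d [psi [psiB psiM psiE]]]].
apply: (@finite_projective_of _ _ _ ('I_m * 'I_n)%type
  (fun ij => g (e ij.2) * d ij.1) (fun ij c => phi ij.2 (psi ij.1 c))).
split=> [[i j] x y|[i j] r c|c] /=; first by rewrite psiB phiB.
  by rewrite psiM phiM.
rewrite [LHS]psiE.
rewrite -(pair_bigA _ (fun i j => g (f (phi j (psi i c))) * (g (e j) * d i))).
apply: eq_bigr => i _ /=; rewrite {1}(phiE (psi i c)) rmorph_sum mulr_suml.
by apply: eq_bigr => j _; rewrite rmorphM mulrA.
Qed.

Lemma finite_projective_id (R : comPzRingType) :
  finite_projective (idfun : {rmorphism R -> R}).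
Proof.
exists 1%N, (fun=> 1), (fun=> id); split=> // a.
by rewrite big_ord1 mulr1.
Qed.

Definition connected (R : comPzRingType) : Prop :=
  (1 : R) <> 0 /\ forall e : R, e * e = e -> e = 0 \/ e = 1.

(** Let M be the matrix of the functionals phi_i on the generators e_j.  It is
    idempotent, hence so is d = det (1 - M), and d kills B because 1 - M kills
    the vector of generators.  As 1 is nonzero in B and R is connected, d = 0.
    But d = 1 modulo the ideal spanned by the entries of M, so 1 is a linear
    combination of values of functionals; the corresponding combination of
    the functionals b |-> phi_i (e_j b) is unital. *)
Lemma finite_projective_split (R B : comPzRingType) (f : {rmorphism R -> B}) :
  connected R -> finite_projective f -> (1 : B) <> 0 ->
  exists psi : B -> R, [/\ zmod_morphism psi,
    forall r x, psi (f r * x) = r * psi x & psi 1 = 1].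
Proof.
move=> [_ Rconn] [n [e [phi [phiB phiM phiE]]]] B1.
pose M := \matrix_(i < n, j < n) phi i (e j).
have phi_sum i (I : finType) (F : I -> B) :
    phi i (\sum_k F k) = \sum_k phi i (F k).
  have [k kE] := additive_of (phiB i).
  by rewrite -kE raddf_sum; apply: eq_bigr => l _; rewrite kE.
have MM : M *m M = M.
  apply/matrixP => i j; rewrite !mxE.
  rewrite [in RHS](phiE (e j)) phi_sum; apply: eq_bigr => k _.
  by rewrite !mxE phiM mulrC.
pose d := \det (1%:M - M).
have dd : d * d = d.
  rewrite /d -det_mulmx; congr (\det _).
  by rewrite mulmxBl mul1mx mulmxBr mulmx1 MM subrr subr0.
have d_ann x : f d * x = 0.
  have col0 : map_mx f (1%:M - M)^T *m \col_i e i = 0.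
    apply/matrixP => i j; rewrite !mxE.
    under eq_bigr do rewrite !mxE rmorphB mulrBl.
    rewrite big_split sumrN /= -[X in _ - X](phiE (e i)).
    rewrite (bigD1 i) //= eqxx rmorph1 mul1r big1 ?addr0 ?subrr // => k ki.
    by rewrite (negPf ki) rmorph0 mul0r.
  have := congr1 (mulmx (\adj (map_mx f (1%:M - M)^T))) col0.
  rewrite mulmxA mul_adj_mx mulmx0 det_map_mx det_tr -/d mul_scalar_mx => de.
  rewrite (phiE x) mulr_sumr big1 // => i _.
  have := congr1 (fun N : 'cV_n => N i ord0) de; rewrite !mxE => dei.
  by rewrite mulrCA dei mulr0.
have d0 : d = 0.
  have [//|d1] := Rconn d dd; case: B1.
  by rewrite -(mulr1 1) -[X in X * _](rmorph1 f) -d1.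
(* The determinant is computed modulo the trace ideal, where M vanishes. *)
pose P := [set r : R | exists i j, r = phi i (e j)]%classic.
have : ideal_span P 1.
  apply/quot_proj_eq0.
  have : quot_proj P d = 1.
    rewrite /d -det_map_mx -[RHS](det1 _ n); congr (\det _).
    apply/matrixP => i j; rewrite !mxE rmorphB rmorph_nat /=.
    have -> : quot_proj P (phi i (e j)) = 0.
      apply/quot_proj_eq0; exists [:: (1, phi i (e j))].
        by move=> p; rewrite inE => /eqP -> /=; exists i, j.
      by rewrite big_seq1 mul1r.
    by rewrite subr0.
  by rewrite d0 rmorph0 rmorph1 => ->.
move=> [s sP s1].
have {}sP : forall p, exists x, p \in s -> exists i, p.2 = phi i x.
  move=> p; have [/sP[i [j pE]]|_] := boolP (p \in s); last by exists 0.
  by exists (e j) => _; exists i.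
have [x xP] := choice sP.
have /choice[k kP] : forall p, exists psi : B -> R, [/\ zmod_morphism psi,
    forall r y, psi (f r * y) = r * psi y & p \in s -> psi 1 = p.2].
  move=> p; have [ps|/negPf pNs] := boolP (p \in s); last first.
    by exists (fun=> 0); split=> [y z|r y|]; rewrite ?subr0 ?mulr0 ?pNs.
  have [i pE] := xP p ps; exists (fun y => phi i (x p * y)); split.
  - by move=> y z; rewrite mulrBr phiB.
  - by move=> r y; rewrite mulrCA phiM.
  - by rewrite mulr1.
exists (fun y => \sum_(p <- s) p.1 * k p y); split.
- move=> y z; rewrite -sumrB; apply: eq_bigr => p _.
  by have [kB _ _] := kP p; rewrite kB mulrBr.
- move=> r y; rewrite mulr_sumr; apply: eq_bigr => p _.
  by have [_ kM _] := kP p; rewrite kM mulrCA.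
rewrite [RHS]s1 !big_seq; apply: eq_bigr => p ps.
by have [_ _ ->] := kP p.
Qed.

(** Let eps in B be the image of the separability idempotent of E under (p, q).
    Then p x eps = q x eps, and eps becomes 1 wherever p and q agree, so that
    forcing p = q amounts to dividing by the idempotent 1 - eps.  The quotient
    is isomorphic to the direct summand eps B, hence finite projective. *)
Lemma coequalize_separable (R E B : comPzRingType) (fE : {rmorphism R -> E})
    (f : {rmorphism R -> B}) (w : tensor fE fE) (p q : {rmorphism E -> B}) :
  separability_elt w -> is_alg_hom fE f p -> is_alg_hom fE f q ->
  finite_projective f ->
  exists (C : comPzRingType) (c : {rmorphism B -> C}),
    [/\ finite_projective (c \o f), forall x, c (p x) = c (q x)
      & forall (A : comPzRingType) (h : {rmorphism B -> A}),
          (forall x, h (p x) = h (q x)) ->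
          exists h' : {rmorphism C -> A}, forall y, h' (c y) = h y].
Proof.
move=> wS pf qf [n [e [phi [phiB phiM phiE]]]].
have [w1 wP] := wS.
have [r|m mE] := @tensor_desc _ _ _ fE fE _ p q; first by rewrite pf qf.
pose eps := m w.
have pqeps x : p x * eps = q x * eps.
  have := congr1 m (wP x).
  by rewrite !rmorphM !mE !rmorph1 mulr1 mul1r.
have epsM : eps * eps = eps.
  have := congr1 m (separability_elt_mul wS w).
  by rewrite w1 rmorph1 mul1r rmorphM.
pose C := quot_ring [set 1 - eps]%classic.
pose c : {rmorphism B -> C} := quot_proj [set 1 - eps]%classic.
have ceps : c eps = 1.
  apply/esym/eqP; rewrite -subr_eq0 -(rmorph1 c) -rmorphB; apply/eqP.
  apply/quot_proj_eq0; exists [:: (1, 1 - eps)]; last by rewrite big_seq1 mul1r.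
  by move=> x; rewrite inE => /eqP ->.
exists C, c; split.
- have eps_eq x y : c x = c y -> eps * x = eps * y.
    move=> /eqP; rewrite -subr_eq0 -rmorphB => /eqP/quot_proj_eq0[s sP sE].
    apply/eqP; rewrite -subr_eq0 -mulrBr sE mulr_sumr big_seq big1 // => z.
    by move=> /sP ->; rewrite mulrCA mulrBr epsM mulr1 subrr mulr0.
  have [l lK] := choice (@quot_proj_surj _ [set 1 - eps]%classic).
  have {}lK u : c (l u) = u by exact: lK.
  exists n, (fun i => c (e i)), (fun i u => phi i (eps * l u)); split.
  + move=> i u v; rewrite -phiB -mulrBr; congr (phi i _); apply: eps_eq.
    by rewrite rmorphB !lK.
  + move=> i r u; rewrite -phiM mulrCA; congr (phi i _); apply: eps_eq.
    by rewrite rmorphM !lK.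
  move=> u; rewrite -[LHS]lK -[LHS]mul1r -ceps -rmorphM.
  rewrite [X in c X]phiE rmorph_sum; apply: eq_bigr => i _ /=.
  by rewrite rmorphM.
- by move=> x; rewrite -[LHS]mulr1 -[RHS]mulr1 -ceps -!rmorphM pqeps.
move=> A h hpq; apply: quot_desc => _ ->.
rewrite rmorphB rmorph1.
suff -> : h eps = h (p (tens_mult w)) by rewrite w1 !rmorph1 subrr.
apply: (@tensor_hom_ext _ _ _ fE fE A (h \o m) (h \o (p \o tens_mult (f:=fE))))
  => x /=.
  by rewrite mE tens_multE rmorph1 !mulr1.
by rewrite mE tens_multE rmorph1 !mul1r hpq.
Qed.

Lemma cid_dep (I : Type) (T : I -> Type) (P : forall i, T i -> Prop) :
  (forall i, exists x, P i x) -> exists x : forall i, T i, forall i, P i (x i).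
Proof.
by move=> PT; exists (fun i => projT1 (cid (PT i))) => i; case: cid.
Qed.

(** * Reduced products over finite sets *)

Section ProductRing.
Variables (I : Type) (T : I -> comPzRingType).

Definition prod_ring : Type := forall i, T i.

HB.instance Definition _ := Choice.on prod_ring.

Let add (x y : prod_ring) : prod_ring := fun i => x i + y i.
Let opp (x : prod_ring) : prod_ring := fun i => - x i.
Let mul (x y : prod_ring) : prod_ring := fun i => x i * y i.

Let ext (x y : prod_ring) : (forall i, x i = y i) -> x = y.
Proof. exact: functional_extensionality_dep. Qed.

Let addA : associative add.
Proof. by move=> x y z; apply: ext => i; exact: addrA. Qed.
Let addC : commutative add.
Proof. by move=> x y; apply: ext => i; exact: addrC. Qed.
Let add0 : left_id (fun i => 0) add.
Proof. by move=> x; apply: ext => i; exact: add0r. Qed.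
Let addN : left_inverse (fun i => 0) opp add.
Proof. by move=> x; apply: ext => i; exact: addNr. Qed.

HB.instance Definition _ := GRing.isZmodule.Build prod_ring addA addC add0 addN.

Let mulA : associative mul.
Proof. by move=> x y z; apply: ext => i; exact: mulrA. Qed.
Let mulC : commutative mul.
Proof. by move=> x y; apply: ext => i; exact: mulrC. Qed.
Let mul1 : left_id (fun i => 1) mul.
Proof. by move=> x; apply: ext => i; exact: mul1r. Qed.
Let mulD : left_distributive mul +%R.
Proof. by move=> x y z; apply: ext => i; exact: mulrDl. Qed.

HB.instance Definition _ :=
  GRing.Zmodule_isComPzRing.Build prod_ring mulA mulC mul1 mulD.

Lemma prod_ringDE (x y : prod_ring) i : (x + y) i = x i + y i.
Proof. by []. Qed.

Lemma prod_ringME (x y : prod_ring) i : (x * y) i = x i * y i.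
Proof. by []. Qed.

End ProductRing.

Section ReducedProduct.
Variables (J : Type) (T : seq J -> comPzRingType).

(** The subsets of the form {w | w contains w0} generate a proper filter on the
    finite sets w of elements of J.  Finite sets are encoded as sequences
    compared through their members, as J carries no decidable equality. *)
Definition eventually (P : seq J -> Prop) : Prop :=
  exists w0, forall w, (forall u, List.In u w0 -> List.In u w) -> P w.

Definition eventually_zero : set (prod_ring T) :=
  [set x | eventually (fun w => x w = 0)]%classic.

Definition reduced_product : comPzRingType := quot_ring eventually_zero.

Definition germ : {rmorphism prod_ring T -> reduced_product} :=
  quot_proj eventually_zero.

Lemma eventuallyT (P : seq J -> Prop) : (forall w, P w) -> eventually P.
Proof. by move=> Pw; exists [::]. Qed.

Lemma eventually_and (P Q : seq J -> Prop) :
  eventually P -> eventually Q -> eventually (fun w => P w /\ Q w).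
Proof.
move=> [v vP] [w wQ]; exists (v ++ w) => z zvw.
by split; [apply: vP|apply: wQ] => u uin;
  apply/zvw/List.in_or_app; [left|right].
Qed.

Lemma germ_eq (x y : prod_ring T) :
  germ x = germ y <-> eventually (fun w => x w = y w).
Proof.
suff span0 (z : prod_ring T) : germ z = 0 <-> eventually (fun w => z w = 0).
  have -> : germ x = germ y <-> germ (x - y) = 0.
    rewrite rmorphB; split=> [->|/eqP]; first exact: subrr.
    by rewrite subr_eq0 => /eqP.
  rewrite span0; split=> -[w0 w0P]; exists w0 => w /w0P.
    by move=> /eqP; rewrite subr_eq0 => /eqP.
  by move=> xy; apply/eqP; rewrite subr_eq0; exact/eqP.
split=> [/quot_proj_eq0[s sP ->]|zP]; last first.
  apply/quot_proj_eq0; exists [:: (1, z)]; last by rewrite big_seq1 mul1r.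
  by move=> p; rewrite inE => /eqP ->.
elim: s sP => [|p s IHs] sP; first by exists [::] => w _; rewrite big_nil.
have /IHs{}IHs : forall q, q \in s -> eventually_zero q.2.
  by move=> q qs; apply: sP; rewrite inE qs orbT.
have /eventually_and/(_ IHs)[w0 w0P] : eventually_zero p.2.
  by apply: sP; rewrite inE eqxx.
exists w0 => w /w0P[p0 s0]; rewrite big_cons.
by rewrite prod_ringDE prod_ringME p0 s0 mulr0 addr0.
Qed.

(** A family of maps each of which is only eventually compatible with the ring
    operations defines a genuine morphism to the reduced product. *)
Lemma germ_rmorphism (A : comPzRingType) (h : A -> prod_ring T) :
  (forall x y, eventually (fun w => h (x - y) w = h x w - h y w)) ->
  (forall x y, eventually (fun w => h (x * y) w = h x w * h y w)) ->
  eventually (fun w => h 1 w = 1) ->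
  exists k : {rmorphism A -> reduced_product}, forall x, k x = germ (h x).
Proof.
move=> hB hM h1; apply: rmorphism_of => [x y|].
  by rewrite -[RHS]rmorphB; apply/germ_eq/hB.
split=> [|x y]; first by apply/germ_eq/h1.
by rewrite -[RHS]rmorphM; apply/germ_eq/hM.
Qed.

End ReducedProduct.

(** * Finite stages of a colimit *)

Record arrow (C : category) :=
  Arrow { src : C; tgt : C; arr : Defs.hom src tgt }.

Definition alg_map (R A B : comPzRingType) (f : {rmorphism R -> A})
    (g : {rmorphism R -> B}) (h : A -> B) : Prop :=
  exists k : {rmorphism A -> B}, is_alg_hom f g k /\ k =1 h.

Section FiniteStages.
Variables (R A : comPzRingType) (f : {rmorphism R -> A}).
Variables (C : category) (D : alg_diagram R C).
Variable c : forall i : C, {rmorphism dob D i -> A}.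
Hypothesis sepD : forall i, strongly_separable (dstr D i).
Hypothesis coconec : is_cocone f c.

(** B is the tensor product of the D i for i in l.  It retains a map to A, the
    only trace of the colimit needed to show that it does not vanish. *)
Lemma finite_stage_objects (l : seq C) :
  exists (B : comPzRingType) (fB : {rmorphism R -> B}) (h : {rmorphism B -> A}),
    [/\ finite_projective fB, is_alg_hom fB f h
      & forall i, List.In i l -> exists v : {rmorphism dob D i -> B},
          is_alg_hom (dstr D i) fB v /\ forall x, h (v x) = c i x].
Proof.
elim: l => [|i l [B [fB [h [fpB hf vP]]]]].
  by exists R, idfun, f; split=> //; exact: finite_projective_id.
have fpi : finite_projective (dstr D i).
  by have [_ fg proj] := sepD i; apply/finite_projectiveP.
have hc r : h (fB r) = c i (dstr D i r) by rewrite hf (cocone_alg coconec).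
have [h' h'E] := tensor_desc hc.
exists (tensor fB (dstr D i)), (tens_inl fB (dstr D i) \o fB), h'.
split=> [||j [<-|/vP[v [vf vc]]]].
- exact: finite_projective_trans fpB (finite_projective_base_change fB fpi).
- by move=> r; rewrite /= h'E rmorph1 mulr1 hf.
- exists (tens_inr fB (dstr D i)); split=> [r|x].
    by rewrite /= tens_in_comm.
  by rewrite h'E rmorph1 mul1r.
exists (tens_inl fB (dstr D i) \o v); split=> [r|x] /=; first by rewrite vf.
by rewrite h'E rmorph1 mulr1 vc.
Qed.

(** The family v is total, with junk values at the objects outside of w, which
    spares any dependence on membership proofs. *)
Lemma finite_stage (w : seq (arrow C)) : (1 : A) <> 0 ->
  exists (B : comPzRingType) (fB : {rmorphism R -> B})
      (v : forall i, dob D i -> B),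
    [/\ finite_projective fB, (1 : B) <> 0
      & forall u, List.In u w -> [/\ alg_map (dstr D (src u)) fB (v (src u)),
          alg_map (dstr D (tgt u)) fB (v (tgt u))
        & forall x, v (tgt u) (dmap D (arr u) x) = v (src u) x]].
Proof.
move=> A1.
pose l := List.app (List.map (@src C) w) (List.map (@tgt C) w).
have [B [fB [h [fpB hf vP]]]] := finite_stage_objects l.
have /cid_dep[v {}vP] : forall i, exists v : dob D i -> B,
    List.In i l -> exists k : {rmorphism dob D i -> B},
      [/\ is_alg_hom (dstr D i) fB k, k =1 v & forall x, h (v x) = c i x].
  move=> i; have [/vP[k [kf kc]]|niw] := pselect (List.In i l).
    by exists k => _; exists k.
  by exists (fun=> 0) => /niw.
have srcP u : List.In u w -> exists k : {rmorphism dob D (src u) -> B},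
    [/\ is_alg_hom (dstr D (src u)) fB k, k =1 v (src u)
      & forall x, h (v (src u) x) = c (src u) x].
  by move=> uw; apply: vP; apply: List.in_or_app; left; exact: List.in_map.
have tgtP u : List.In u w -> exists k : {rmorphism dob D (tgt u) -> B},
    [/\ is_alg_hom (dstr D (tgt u)) fB k, k =1 v (tgt u)
      & forall x, h (v (tgt u) x) = c (tgt u) x].
  by move=> uw; apply: vP; apply: List.in_or_app; right; exact: List.in_map.
have [B' [q [h' [fpB' h'q qP]]]] : exists (B' : comPzRingType)
    (q : {rmorphism B -> B'}) (h' : {rmorphism B' -> A}),
    [/\ finite_projective (q \o fB), forall y, h' (q y) = h y
      & forall u, List.In u w ->
          forall x, q (v (tgt u) (dmap D (arr u) x)) = q (v (src u) x)].
  (* The arrows are imposed one at a time, always on the images of the same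
     maps v into B. *)
  elim: w {l vP} srcP tgtP => [|u w IHw] srcP tgtP.
    by exists B, idfun, h.
  have [||B1 [q1 [h1 [fpB1 h1q q1P]]]] := IHw.
  - by move=> u' u'w; apply: srcP; right.
  - by move=> u' u'w; apply: tgtP; right.
  have [ks [ksf ksv hs]] := srcP u (or_introl erefl).
  have [kt [ktf ktv ht]] := tgtP u (or_introl erefl).
  have [[_ /separableP[e eP]] _ _] := sepD (src u).
  have [||B2 [q2 [fpB2 q2P h2]]] :=
    @coequalize_separable _ _ _ _ (q1 \o fB) e (q1 \o (kt \o dmap D (arr u)))
      (q1 \o ks) eP _ _ fpB1.
  - by move=> r /=; rewrite (dmap_alg D (arr u)) ktf.
  - by move=> r /=; rewrite ksf.
  have [|h2' h2'q] := h2 A h1.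
    by move=> x /=; rewrite !h1q ktv ksv ht hs (cocone_comm coconec).
  exists B2, (q2 \o q1), h2'; split=> //.
  - by move=> y /=; rewrite h2'q h1q.
  move=> u' [<-|/q1P qu] x /=; last by rewrite qu.
  by have := q2P x; rewrite /= ktv ksv.
exists B', (q \o fB), (fun i x => q (v i x)); split=> //.
  move=> B1; apply: A1; rewrite -(rmorph1 h') B1; exact: rmorph0.
move=> u uw; have [ks [ksf ksv _]] := srcP u uw.
have [kt [ktf ktv _]] := tgtP u uw; split; last exact: qP.
  exists (q \o ks); split=> [r|x] /=; last by rewrite ksv.
  by rewrite ksf.
exists (q \o kt); split=> [r|x] /=; last by rewrite ktv.
by rewrite ktf.
Qed.

End FiniteStages.

(** * Base change of locally strongly separable extensions *)

(** An element of S that dies in T dies in every S-algebra receiving a cocone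
    from the diagram, in particular in the reduced product of the
    S (x)_R B_w; it is then zero in some S (x)_R B_w, in which S embeds. *)
Lemma colimit_base_change_injective (R A : comPzRingType)
    (f : {rmorphism R -> A}) (C : category) (D : alg_diagram R C)
    (c : forall i : C, {rmorphism dob D i -> A}) (S T : comPzRingType)
    (g : {rmorphism R -> S}) (a : {rmorphism S -> T}) (b : {rmorphism A -> T}) :
  connected R -> (1 : A) <> 0 -> (forall i, strongly_separable (dstr D i)) ->
  is_colimit f c -> is_pushout g f a b -> injective a.
Proof.
move=> Rconn A1 sepD [coc univ] [_ desc _].
pose stage := {B : comPzRingType & {fB : {rmorphism R -> B} &
  forall i, dob D i -> B}}.
have /choice[X XP] : forall w : seq (arrow C), exists X : stage,
    [/\ finite_projective (projT1 (projT2 X)), (1 : projT1 X) <> 0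
      & forall u, List.In u w ->
        [/\ alg_map (dstr D (src u)) (projT1 (projT2 X))
              (projT2 (projT2 X) (src u)),
            alg_map (dstr D (tgt u)) (projT1 (projT2 X))
              (projT2 (projT2 X) (tgt u))
          & forall x, projT2 (projT2 X) (tgt u) (dmap D (arr u) x) =
              projT2 (projT2 X) (src u) x]].
  move=> w; have [B [fB [v vP]]] := finite_stage sepD coc w A1.
  by exists (existT _ B (existT _ fB v)).
pose fB w := projT1 (projT2 (X w)).
pose v w i : dob D i -> projT1 (X w) := projT2 (projT2 (X w)) i.
pose Z w : comPzRingType := tensor g (fB w).
pose inlZ w : {rmorphism S -> Z w} := tens_inl g (fB w).
pose inrZ w : {rmorphism projT1 (X w) -> Z w} := tens_inr g (fB w).
have vmorph i : eventually (fun w => alg_map (dstr D i) (fB w) (v w i)).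
  (* An identity arrow serves to require the presence of its object. *)
  exists [:: Arrow (idm i)] => w wP.
  have [_ _ /(_ (Arrow (idm i)))[|//]] := XP w.
  by apply: wP; left.
have [|||str strE] := @germ_rmorphism _ Z S (fun s w => inlZ w s).
- by move=> x y; apply: eventuallyT => w; rewrite rmorphB.
- by move=> x y; apply: eventuallyT => w; rewrite rmorphM.
- by apply: eventuallyT => w; rewrite rmorph1.
have /cid_dep[k kE] : forall i,
    exists k : {rmorphism dob D i -> reduced_product Z}, forall x,
      k x = germ Z (fun w => inrZ w (v w i x)).
  move=> i; apply: germ_rmorphism => [x y|x y|]; have [w0 w0P] := vmorph i;
    exists w0 => w /w0P[h [_ hE]].
  - by rewrite -!hE !rmorphB.
  - by rewrite -!hE !rmorphM.
  - by rewrite -hE !rmorph1.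
have cocQ : @is_cocone _ _ D _ (str \o g) k.
  split=> [i r|i j u x]; rewrite /= ?strE !kE; apply/germ_eq.
    have [w0 w0P] := vmorph i; exists w0 => w /w0P[h [hf hE]].
    by rewrite -hE hf; exact/esym/tens_in_comm.
  exists [:: Arrow u] => w wP; have [_ _ /(_ (Arrow u))[|_ _ vu]] := XP w.
    by apply: wP; left.
  by congr (inrZ w _); exact: vu.
have [h [hf _ _]] := univ _ _ _ cocQ.
have [r|z [za _]] := desc _ str h; first by rewrite hf.
move=> s s' /(congr1 z); rewrite !za !strE => /germ_eq[w /(_ w)].
have [fpB B1 _] := XP w.
have [psi [psiB psiM psi1]] := finite_projective_split Rconn fpB B1.
by move=> /(_ (fun=> id)); exact: (base_change_injective psiB psiM psi1).
Qed.

Section BaseChangeDiagram.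
Variables (R S : comPzRingType) (g : {rmorphism R -> S}).
Variables (C : category) (D : alg_diagram R C).

Lemma base_change_map_exists (i j : C) (u : Defs.hom i j) :
  exists h : {rmorphism tensor g (dstr D i) -> tensor g (dstr D j)},
    forall s x, h (tens g (dstr D i) s x) = tens g (dstr D j) s (dmap D u x).
Proof.
have [r|h hE] := @tensor_desc _ _ _ g (dstr D i) _ (tens_inl g (dstr D j))
  (tens_inr g (dstr D j) \o dmap D u).
  by rewrite /= (dmap_alg D u) tens_in_comm.
by exists h => s x; rewrite hE -tens_factor.
Qed.

Definition base_change_map (i j : C) (u : Defs.hom i j) :=
  projT1 (cid (base_change_map_exists u)).

Lemma base_change_mapE (i j : C) (u : Defs.hom i j) s x :
  base_change_map u (tens g (dstr D i) s x) =
  tens g (dstr D j) s (dmap D u x).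
Proof. by rewrite /base_change_map; case: cid. Qed.

Lemma base_change_map_alg (i j : C) (u : Defs.hom i j) :
  is_alg_hom (tens_inl g (dstr D i)) (tens_inl g (dstr D j))
    (base_change_map u).
Proof. by move=> s; rewrite base_change_mapE rmorph1. Qed.

Lemma base_change_map_id (i : C) t : base_change_map (idm i) t = t.
Proof.
apply: (tensor_hom_ext (h' := idfun)) => x /=;
  by rewrite base_change_mapE dmap_id.
Qed.

Lemma base_change_map_comp (i j l : C) (u : Defs.hom i j) (v : Defs.hom j l) t :
  base_change_map (hcomp u v) t = base_change_map v (base_change_map u t).
Proof.
apply: (tensor_hom_ext (h' := base_change_map v \o base_change_map u)) => x /=;
  by rewrite !base_change_mapE dmap_comp.
Qed.

Definition base_change_diagram : alg_diagram S C :=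
  AlgDiagram base_change_map_alg base_change_map_id base_change_map_comp.

End BaseChangeDiagram.

Lemma strongly_separable_base_change (R S A : comPzRingType)
    (g : {rmorphism R -> S}) (f : {rmorphism R -> A}) :
  connected R -> strongly_separable f -> strongly_separable (tens_inl g f).
Proof.
move=> Rconn [[finj /separableP[w wP]] fg proj].
have fpf : finite_projective f by apply/finite_projectiveP.
have [fg' proj'] :=
  (finite_projectiveP _).2 (finite_projective_base_change g fpf).
split=> //; split; last exact/separableP/(separability_base_change g wP).
have [psi [psiB psiM psi1]] : exists psi : A -> R, [/\ zmod_morphism psi,
    forall r x, psi (f r * x) = r * psi x & psi 1 = 1].
  apply: finite_projective_split => // A1; apply: (proj1 Rconn).
  by apply: finj; rewrite rmorph1 rmorph0.
exact: base_change_injective psiB psiM psi1.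
Qed.

Lemma colimit_base_change (R A S T : comPzRingType)
    (f : {rmorphism R -> A}) (C : category) (D : alg_diagram R C)
    (c : forall i : C, {rmorphism dob D i -> A})
    (g : {rmorphism R -> S}) (a : {rmorphism S -> T}) (b : {rmorphism A -> T}) :
  is_colimit f c -> is_pushout g f a b ->
  exists c' : forall i, {rmorphism dob (base_change_diagram g D) i -> T},
    is_colimit a c'.
Proof.
move=> [coc univ] [comm desc ext].
have /cid_dep[c' c'E] : forall i,
    exists h : {rmorphism tensor g (dstr D i) -> T}, forall s x,
      h (tens g (dstr D i) s x) = a s * b (c i x).
  move=> i; apply: (tensor_desc (u := a) (v := b \o c i)) => r.
  by rewrite /= (cocone_alg coc).
exists c'; split; first split=> [i s|i j u t] /=.
- by rewrite c'E !rmorph1 mulr1.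
- apply: (tensor_hom_ext (h := c' j \o base_change_map g D u)) => x /=;
    by rewrite base_change_mapE !c'E ?rmorph1 // (cocone_comm coc).
move=> B p d [dalg dcomm].
have coc' : @is_cocone _ _ D _ (p \o g) (fun i => d i \o tens_inr g (dstr D i)).
  split=> [i r|i j u x] /=.
    rewrite -[RHS](dalg i) -tens_in_comm; congr (d i _).
  rewrite -(dcomm i j u); congr (d j _).
  by rewrite /= base_change_mapE.
have [h [hf hc huniq]] := univ _ _ _ coc'.
have [r|k [ka kb]] := desc _ p h; first by rewrite hf.
exists k; split=> [//|i t|k' k'a k'c].
  apply: (tensor_hom_ext (h := k \o c' i)) => x /=.
    by rewrite c'E !rmorph1 mulr1 ka -(dalg i).
  by rewrite c'E rmorph1 mul1r kb hc.
apply: ext => [s|x]; first by rewrite ka k'a.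
rewrite kb -[LHS]/((k' \o b) x); apply: huniq => [r|i y] /=.
  by rewrite -comm k'a.
by rewrite -[d i _]k'c c'E rmorph1 mul1r.
Qed.

Lemma locally_strongly_separable_base_change (R A S T : comPzRingType)
    (f : {rmorphism R -> A}) (g : {rmorphism R -> S})
    (a : {rmorphism S -> T}) (b : {rmorphism A -> T}) :
  connected R -> locally_strongly_separable f -> is_pushout g f a b ->
  locally_strongly_separable a.
Proof.
move=> Rconn [finj [C [D [c [sepD colim]]]]] po; split.
  apply: colimit_base_change_injective (Rconn) _ sepD colim po => A1.
  by apply: (proj1 Rconn); apply: finj; rewrite rmorph1 rmorph0.
have [c' c'P] := colimit_base_change colim po.
exists C, (base_change_diagram g D), c'; split=> // i.
exact: strongly_separable_base_change (sepD i).
Qed.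

(** * Pierce components *)

Section Idempotents.
Variable R : comPzRingType.
Implicit Types e h : R.

Lemma idempotentM e h :
  idempotents e -> idempotents h -> idempotents (e * h).
Proof. by rewrite /idempotents /= => ee hh; rewrite mulrACA ee hh. Qed.

Lemma idempotentC e : idempotents e -> idempotents (1 - e).
Proof.
rewrite /idempotents /= => ee.
by rewrite mulrBr mulr1 mulrBl mul1r ee subrr subr0.
Qed.

Lemma idempotentU e h :
  idempotents e -> idempotents h -> idempotents (e + h - e * h).
Proof.
move=> ee hh; have -> : e + h - e * h = 1 - (1 - e) * (1 - h).
  by rewrite mulrBr mulr1 mulrBl mul1r !opprB addrCA (addrCA 1) subrr addr0
    addrC addrA.
by apply/idempotentC/idempotentM; exact: idempotentC.
Qed.

End Idempotents.

Section PierceComponents.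
Variable R : comPzRingType.

(** Finitely many elements of a Boolean ideal lie below their join, so a single
    idempotent p suffices to witness membership in the ideal it spans. *)
Lemma bool_ideal_span (x : bool_spec R) t :
  ideal_span x t <-> exists2 p, bool_spec_set x p & p * t = t.
Proof.
split=> [[s sP ->]|[p xp pt]]; last first.
  exists [:: (t, p)]; first by move=> q; rewrite inE => /eqP ->.
  by rewrite big_seq1 mulrC pt.
have [_ x0 xU _ _ _] := bool_specP x.
elim: s sP => [|q s IHs] sP; first by exists 0; rewrite ?big_nil ?mulr0.
have [|p xp ps] := IHs; first by move=> r rs; apply: sP; rewrite inE rs orbT.
have xq : bool_spec_set x q.2 by apply: sP; rewrite inE eqxx.
have qq : q.2 * q.2 = q.2 by apply: (bool_prime_sub (bool_specP x)).
exists (q.2 + p - q.2 * p); first exact: xU.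
rewrite big_cons mulrDr; congr (_ + _).
  by rewrite mulrC -mulrA; congr (_ * _); rewrite mulrBr mulrDr mulrA qq addrK.
by rewrite mulrBl mulrDl -mulrA ps addrAC subrr add0r.
Qed.

(** If e is idempotent modulo P_x R, then p (e^2 - e) = e^2 - e for some p in
    P_x, and e (1 - p) is an idempotent of R lifting the class of e.  As P_x is
    prime, it contains this idempotent or its complement. *)
Lemma component_connected (x : bool_spec R) : connected (component x).
Proof.
have [xE x0 _ _ x1 xP] := bool_specP x; split=> [|u].
  move=> /quot_proj_eq0/bool_ideal_span[p xp].
  by rewrite mulr1 => p1; apply: x1; rewrite -p1.
have [e <-] := quot_proj_surj u; rewrite -rmorphM => /eqP.
rewrite -subr_eq0 -rmorphB => /eqP/quot_proj_eq0/bool_ideal_span[p xp].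
move=> pe; have pp := xE p xp.
have pz : quot_proj x p = 0.
  by apply/quot_proj_eq0/bool_ideal_span; exists p.
pose h := e * (1 - p).
have pe0 : (e * e - e) * (1 - p) = 0.
  by rewrite mulrC mulrBl mul1r pe subrr.
have hh : h * h = h.
  have -> : h * h = e * e * (1 - p).
    by rewrite /h mulrACA; congr (_ * _); exact: idempotentC.
  by apply/eqP; rewrite /h -subr_eq0 -mulrBl pe0.
have projh : quot_proj x h = quot_proj x e.
  by rewrite /h rmorphM rmorphB /= pz rmorph1 subr0 mulr1.
have [|xh|xh] := xP h (1 - h) hh (idempotentC hh).
- by rewrite mulrBr mulr1 hh subrr.
- by left; rewrite -projh; apply/quot_proj_eq0/bool_ideal_span; exists h.
right; apply/eqP; rewrite -projh -subr_eq0 -(rmorph1 (quot_proj x)) -rmorphB.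
apply/eqP/quot_proj_eq0/bool_ideal_span; exists (1 - h) => //.
by rewrite -(opprB 1 h) mulrN (idempotentC hh).
Qed.

(** If t is nonzero, the idempotents e with e t = t form a proper filter, and a
    Boolean ideal maximal among those disjoint from it is prime.  At the
    corresponding point t does not vanish. *)
Lemma components_separate (t : R) :
  (forall x : bool_spec R, quot_proj x t = 0) -> t = 0.
Proof.
move=> t0; apply: contrapT => /eqP tn0.
(* Membership of 0 is not required here, so that the union of the empty chain
   qualifies; a maximal such set contains 0 anyway. *)
pose ideal (P : set R) := [/\ (P `<=` @idempotents R)%classic,
  forall e h, P e -> P h -> P (e + h - e * h),
  forall e h, P e -> idempotents h -> P (e * h)
  & forall e, P e -> e * t != t].
have [F FI Ftot|A [[AE AU AI At] Amax]] := @Zorn_bigcup R ideal.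
  split.
  - by move=> e [P /FI[PE _ _ _] /PE].
  - move=> e h [P FP Pe] [Q FQ Qh].
    have [PQ|QP] := Ftot _ _ FP FQ; [exists Q|exists P] => //.
      by have [_ QU _ _] := FI Q FQ; apply: QU => //; apply: PQ.
    by have [_ PU _ _] := FI P FP; apply: PU => //; apply: QP.
  - move=> e h [P FP Pe] hh; exists P => //.
    by have [_ _ PI _] := FI P FP; apply: PI.
  - by move=> e [P /FI[_ _ _ Pt] /Pt].
have A0 : A 0.
  apply: contrapT => nA0; apply: (Amax [set 0]%classic).
    split=> [e Ae|A0]; last by apply: nA0; apply: A0.
    by case: nA0; rewrite -(mulr0 e); apply: AI => //; exact: mulr0.
  split.
  - by move=> _ ->; exact: mulr0.
  - by move=> _ _ -> ->; rewrite mulr0 subr0 addr0.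
  - by move=> _ h -> _; rewrite mul0r.
  - by move=> _ ->; rewrite mul0r eq_sym.
(* The colon ideal of A by h contains A, and equals it by maximality when it is
   disjoint from the filter. *)
have colon h : idempotents h ->
    (forall e, idempotents e -> A (e * h) -> e * t != t) ->
    forall e, idempotents e -> A (e * h) -> A e.
  move=> hh disj e ee Aeh; apply: contrapT => nAe.
  apply: (Amax [set z | idempotents z /\ A (z * h)]%classic).
    split=> [z Az|sub]; last by apply: nAe; apply: sub.
    by split; [exact: AE|exact: AI].
  split.
  - by move=> z [].
  - move=> y z [yy Ayh] [zz Azh]; split; first exact: idempotentU.
    have -> : (y + z - y * z) * h = y * h + z * h - (y * h) * (z * h).
      by rewrite mulrBl mulrDl mulrACA hh.
    exact: AU.
  - move=> y z [yy Ayh] zz; split; first exact: idempotentM.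
    by rewrite mulrAC; exact: AI.
  - by move=> z [zz Azh]; exact: disj.
have Aprime : is_bool_prime A.
  split=> // [A1|e h ee hh Aeh].
    by have := At 1 A1; rewrite mul1r eqxx.
  (* If the colon ideal of A by h meets the filter at x, then that by x does
     not: z x in A and z t = t would give (z x) t = t. *)
  have [disj|] := pselect (forall z, idempotents z -> A (z * h) -> z * t != t).
    by left; exact: (colon h hh disj).
  move=> /existsNP[x /not_implyP[xx /not_implyP[Axh /negP]]].
  rewrite negbK => /eqP xt; right; apply: (colon x xx); rewrite 1?mulrC //.
  by move=> z zz Azx; have := At _ Azx; rewrite -mulrA xt.
have /quot_proj_eq0/bool_ideal_span[p Ap pt] := t0 (BoolSpec Aprime).
by have := At p Ap; rewrite pt eqxx.
Qed.

End PierceComponents.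

Section Specialization.
Variables (R S : comPzRingType) (g : {rmorphism R -> S}) (y : bool_spec S).

Definition preimage_idempotents : set R :=
  [set e | idempotents e /\ bool_spec_set y (g e)]%classic.

Lemma preimage_is_bool_prime : is_bool_prime preimage_idempotents.
Proof.
have [yE y0 yU yI y1 yP] := bool_specP y.
have idemg e : idempotents e -> idempotents (g e).
  by move=> ee; rewrite /idempotents /= -rmorphM ee.
split.
- by move=> e [].
- by split; [exact: mulr0|rewrite rmorph0].
- move=> e h [ee ye] [hh yh]; split; first exact: idempotentU.
  by rewrite rmorphB rmorphD rmorphM; exact: yU.
- move=> e h [ee ye] hh; split; first exact: idempotentM.
  by rewrite rmorphM; apply: yI => //; exact: idemg.
- by move=> [_]; rewrite rmorph1.
move=> e h ee hh [_]; rewrite rmorphM => yeh.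
have [||ye|yh] := yP _ _ _ _ yeh; rewrite ?idemg //; first exact: idemg.
- exact: idemg.
- by left.
- by right.
Qed.

Definition bool_spec_preimage : bool_spec R := BoolSpec preimage_is_bool_prime.

Lemma component_map :
  exists h : {rmorphism component bool_spec_preimage -> component y},
    forall r, h (quot_proj _ r) = quot_proj y (g r).
Proof.
apply: (@quot_desc R (component y) _ (quot_proj y \o g)) => e [ee ye] /=.
by apply/quot_proj_eq0/bool_ideal_span; exists (g e); rewrite // -rmorphM ee.
Qed.

End Specialization.

(** Both S_y (x)_S (S (x)_R A) and S_y (x)_{R_x} (R_x (x)_R A) are the pushout of
    S_y and A over R, because a map out of R_x (x)_R A that is prescribed on
    R_x is the same as a compatible map out of A. *)
Lemma component_pushout (R S A : comPzRingType) (g : {rmorphism R -> S})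
    (f : {rmorphism R -> A}) (y : bool_spec S)
    (h : {rmorphism component (bool_spec_preimage g y) -> component y}) :
  (forall r, h (quot_proj _ r) = quot_proj y (g r)) ->
  exists b : {rmorphism tensor (quot_proj (bool_spec_preimage g y)) f ->
                        tensor (quot_proj y) (tens_inl g f)},
    is_pushout h (tens_inl (quot_proj (bool_spec_preimage g y)) f)
      (tens_inl (quot_proj y) (tens_inl g f)) b.
Proof.
set x := bool_spec_preimage g y => hE.
pose a := tens_inl (quot_proj y) (tens_inl g f).
pose i := tens_inr (quot_proj y) (tens_inl g f) \o tens_inr g f.
have ai r : a (quot_proj y (g r)) = i (f r).
  by rewrite /a tens_in_comm /= tens_in_comm.
have [r|b bE] := @tensor_desc _ _ _ (quot_proj x) f _ (a \o h) i.
  by rewrite /= hE; exact: ai.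
have bl u : b (tens_inl _ _ u) = a (h u) by rewrite bE rmorph1 mulr1.
have br z : b (tens_inr _ _ z) = i z by rewrite bE rmorph1 mul1r.
exists b; split=> [r|Z p q pq|Z k k' ka kb]; first by rewrite bl.
  have [r|m mE] := @tensor_desc _ _ _ g f _ (p \o quot_proj y)
      (q \o tens_inr (quot_proj x) f).
    by rewrite /= -hE pq; congr (q _); exact: tens_in_comm.
  have [s|n nE] := @tensor_desc _ _ _ (quot_proj y) (tens_inl g f) _ p m.
    by rewrite mE rmorph1 mulr1.
  have na s : n (a s) = p s by rewrite nE rmorph1 mulr1.
  exists n; split=> //.
  apply: (tensor_hom_ext (h := n \o b)) => z /=; first by rewrite bl na pq.
  by rewrite br nE rmorph1 mul1r mE rmorph1 mul1r.
apply: tensor_hom_ext => // t.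
apply: (tensor_hom_ext (h := k \o tens_inr (quot_proj y) (tens_inl g f))
  (h' := k' \o tens_inr (quot_proj y) (tens_inl g f))) => z /=.
  by rewrite -tens_in_comm ka.
by have := kb (tens_inr _ _ z); rewrite br.
Qed.

(** * Base change of clss extensions and the theorem *)

Theorem clss_base_change (R S A : comPzRingType) (f : {rmorphism R -> A})
    (g : {rmorphism R -> S}) :
  clss f -> clss (tens_inl g f).
Proof.
move=> [_ lssf].
have lss y : locally_strongly_separable
    (tens_inl (quot_proj y) (tens_inl g f) :
       {rmorphism component y -> tensor (quot_proj y) (tens_inl g f)}).
  have [h hE] := component_map g y.
  have [b po] := component_pushout f hE.
  exact: locally_strongly_separable_base_change (component_connected _)
    (lssf _) po.
split=> // s s' ss'; apply/eqP; rewrite -subr_eq0; apply/eqP.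
apply: components_separate => y; have [inj _] := lss y.
apply: inj; rewrite rmorph0; apply: etrans (tens_in_comm _ _ _) _.
by rewrite rmorphB ss' subrr rmorph0.
Qed.

Theorem lemma3p32 (k : diffRing) (L0 : comPzRingType)
    (eta : {rmorphism underlying k -> L0}) (hL0 : separable_closure eta) :
  exists sbar : {rmorphism L0 -> L0},
    @difference_extension k (DiffRing sbar) eta.
Proof.
have [closed [clss_eta _]] := hL0.
pose g := eta \o diff_op k.
have [h hE] := closed _ _ (clss_base_change g clss_eta).
exists (h \o tens_inr g eta); split=> [|r] /=; first exact: (proj1 clss_eta).
by rewrite -tens_in_comm hE.
Qed.
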